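(* Let $s\ge 0$ be an integer and let $M$ be a compact metric space with covering dimension $\dim M\leqslant s$. Then there exists a total order $T$ on $M$ for which $\operatorname{Snake}(M,T)\leqslant 2s+1$.
   Context: A total order $T$ on a metric space $M$ is a strict total order $<_T$ on the set of points (for distinct $x,y$ exactly one of $x<_T y$, $y<_T x$ holds, and $<_T$ is transitive); no compatibility with the topology is assumed. $B_\varepsilon(x)$ denotes the open ball of radius $\varepsilon$ around $x$. For an ordered pair $(U_1,U_2)$ of subsets of $M$ and an integer $k\ge 0$, we say $(U_1,U_2)$ contains a snake of length $k$ if there are points $a_0 <_T a_1 <_T \dots <_T a_k$ such that $a_i\in U_1$ for all even $i$ and $a_i\in U_2$ for all odd $i$ ($0\le i\le k$). For distinct $x,y\in M$, $\operatorname{Snake}_T(x,y)$ is the greatest integer $k$ such that for every $\varepsilon>0$ the pair $(B_\varepsilon(x),B_\varepsilon(y))$ contains a snake of length $k$; if no greatest such number exists, $\operatorname{Snake}_T(x,y)=\infty$. The snake number of $(M,T)$ is $\operatorname{Snake}(M,T)=\sup_{x,y\in M,\,x\ne y}\operatorname{Snake}_T(x,y)\in\{0,1,2,\dots\}\cup\{\infty\}$, where the supremum is taken to be $0$ if $M$ has at most one point. Covering dimension: the order of a family $\mathcal A$ of sets is the largest integer $n$ such that $\mathcal A$ contains $n+1$ sets with non-empty intersection ($\infty$ if there is no such integer). For an integer $n\ge -1$, $\dim M\le n$ means that every finite open cover of $M$ has a finite open refinement of order $\le n$; $\dim M$ is the least such $n$, or $\infty$ if none exists; $\dim\emptyset=-1$.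 *)

(* Defs.v *)
From HB Require Import structures.
From mathcomp Require Import all_boot all_order all_algebra.
From mathcomp Require Import all_classical all_reals all_analysis.

Set Implicit Arguments.
Unset Strict Implicit.
Unset Printing Implicit Defensive.

Import Order.TTheory GRing.Theory Num.Theory.

Local Open Scope classical_set_scope.
Local Open Scope ring_scope.

Definition strict_total_order (T : Type) (lt : T -> T -> Prop) : Prop :=
  [/\ forall x, ~ lt x x,
      forall x y z, lt x y -> lt y z -> lt x z &
      forall x y, x <> y -> (lt x y /\ ~ lt y x) \/ (lt y x /\ ~ lt x y)].

(* Only the values [a 0], ..., [a k] matter. *)
Definition has_snake (T : Type) (lt : T -> T -> Prop) (U1 U2 : set T)
    (k : nat) : Prop :=
  exists a : nat -> T,
    (forall i, (i < k)%N -> lt (a i) (a i.+1)) /\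
    (forall i, (i <= k)%N -> (if odd i then U2 else U1) (a i)).

(* The greatest element of [A], or [+oo] if there is none: the set given to
   [xget] has at most one element, and [+oo] is the default value. *)
Definition greatest_or_oo (R : realType) (A : set nat) : \bar R :=
  xget +oo%E [set k%:R%:E | k in A `&` ubound A].

Definition snake_at (R : realType) (M : metricType R) (lt : M -> M -> Prop)
    (x y : M) : \bar R :=
  greatest_or_oo R
    [set k | forall e : R, 0 < e -> has_snake lt (ball x e) (ball y e) k].

(* All the values [snake_at lt x y] are nonnegative; adding [0] to them only
   matters when [M] has at most one point. *)
Definition snake_number (R : realType) (M : metricType R)
    (lt : M -> M -> Prop) : \bar R :=
  ereal_sup (0%E |`
    [set snake_at lt p.1 p.2 | p in [set p : M * M | p.1 <> p.2]]).

Definition family_order_le (T : Type) (A : set (set T)) (n : nat) : Prop :=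
  forall (m : nat) (B : set (set T)),
    B `<=` A -> (B #= `I_m.+1)%card -> \bigcap_(U in B) U !=set0 -> (m <= n)%N.

Definition finite_open_cover (T : topologicalType) (A : set (set T)) : Prop :=
  [/\ finite_set A, forall U, A U -> open U & \bigcup_(U in A) U = setT].

Definition refines (T : Type) (B A : set (set T)) : Prop :=
  forall V, B V -> exists2 U, A U & V `<=` U.

(* [dim T <= n] for the covering dimension and [n >= 0]; it holds for every
   such [n] when [T] is empty, in accordance with [dim set0 = -1]. *)
Definition covering_dim_le (T : topologicalType) (n : nat) : Prop :=
  forall A : set (set T), finite_open_cover A ->
    exists B : set (set T),
      [/\ finite_open_cover B, refines B A & family_order_le B n].

(* Main.v *)
(** Choose finite open covers [V n] of order at most [s] and mesh tending to [0]
    such that every member of [V n.+1] has a uniform neighbourhood inside some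
    member of [V n], its parent.  By König's lemma every point [x] has a thread
    [l x n] in [V n] with [x] in [l x n] and [l x n] the parent of [l x n.+1];
    then [l x n] contains a ball around [x] whose radius depends only on [n].
    Order the points lexicographically by their threads, so that the classes
    [{x | l x n = W}] are convex.  Let [n] be such that no member of [V n]
    contains both [x] and [y].  Along a sufficiently fine snake for [(x, y)],
    the sets [l a n] at the points [a] of even index all contain [x], and two
    of them cannot be equal: by convexity they would equal the set at an odd
    point in between, which contains [y].  As at most [s + 1] members of [V n]
    contain [x], there are at most [s + 1] even points. *)
Require Import Defs.
From HB Require Import structures.
From mathcomp Require Import all_boot all_order all_algebra.
From mathcomp Require Import all_classical all_reals all_analysis.

Set Implicit Arguments.
Unset Strict Implicit.
Unset Printing Implicit Defensive.

Import Order.TTheory GRing.Theory Num.Theory.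

Local Open Scope classical_set_scope.
Local Open Scope ring_scope.

(** A bounded [A] with [A 0] has a greatest element, so the default [+oo] is not reached. *)
Lemma greatest_or_oo_le (R : realType) (A : set nat) (n : nat) :
  A 0%N -> (forall k, A k -> (k <= n)%N) ->
  (greatest_or_oo R A <= n%:R%:E)%E.
Proof.
move=> A0 An.
have exA : exists k, `[< A k >] by exists 0%N; apply/asboolP.
have ubA k : `[< A k >] -> (k <= n)%N by move/asboolP/An.
rewrite /greatest_or_oo; case: xgetP => [_ _ [k [Ak _] <-]|no].
  by rewrite lee_fin ler_nat An.
case: (ex_maxnP exA ubA) => k /asboolP Ak kmax.
case: (no k%:R%:E); exists k => //; split=> // j Aj.
by rewrite leEnat kmax//; apply/asboolP.
Qed.

(** * Lexicographic orders given by sequences of naturals *)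

Definition lexlt (T : Type) (c : T -> nat -> nat) (x y : T) : Prop :=
  exists2 n, (c x n < c y n)%N & forall m, (m < n)%N -> c x m = c y m.

Lemma lexlt_trans (T : Type) (c : T -> nat -> nat) (x y z : T) :
  lexlt c x y -> lexlt c y z -> lexlt c x z.
Proof.
move=> [p xyp xy] [q yzq yz]; case: (ltngtP p q) => [pq|qp|pq].
- exists p; first by rewrite -(yz p pq).
  by move=> m mp; rewrite xy// yz// (ltn_trans mp).
- exists q; first by rewrite (xy q qp).
  by move=> m mq; rewrite xy ?yz// (ltn_trans mq).
- rewrite -pq in yzq yz; exists p; first exact: ltn_trans yzq.
  by move=> m mp; rewrite xy ?yz.
Qed.

Lemma lexlt_total_order (T : Type) (c : T -> nat -> nat) :
  (forall x y, c x =1 c y -> x = y) -> strict_total_order (lexlt c).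
Proof.
move=> c_inj; have irr x : ~ lexlt c x x by case=> n; rewrite ltnn.
split=> // [x y z|x y xy]; first exact: lexlt_trans.
suff [h|h] : lexlt c x y \/ lexlt c y x.
- by left; split=> // /(lexlt_trans h)/irr.
- by right; split=> // /(lexlt_trans h)/irr.
have exn : exists n, c x n != c y n.
  apply: contrapT => no; apply: xy; apply: c_inj => n.
  by apply/eqP/negPn/negP => xyn; apply: no; exists n.
case: (ex_minnP exn) => n neq nmin.
have eqm m : (m < n)%N -> c x m = c y m.
  by move=> mn; apply/eqP/negPn/negP => /nmin; rewrite leqNgt mn.
by move: neq; rewrite neq_ltn => /orP[]; [left|right]; exists n => // m /eqm.
Qed.

(** If [x] and [y] first differed at [p <= n], and [y] and [z] at [q], then at the smaller of [p]
    and [q] the code of [x] would be strictly below that of [z], although the two agree up to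
    [n]. *)
Lemma lexlt_convex (T : Type) (c : T -> nat -> nat) (n : nat) (x y z : T) :
  lexlt c x y -> lexlt c y z -> (forall m, (m <= n)%N -> c x m = c z m) ->
  c y n = c x n.
Proof.
move=> [p xyp xy] [q yzq yz] xz; case: (ltnP n p) => [/xy//|pn].
case: (ltngtP p q) => [pq|qp|pq].
- by move: xyp; rewrite yz// xz// ltnn.
- by move: yzq; rewrite -xy// xz ?ltnn// (leq_trans (ltnW qp)).
- by move: yzq; rewrite -pq -xz// => /(ltn_trans xyp); rewrite ltnn.
Qed.

(** * Threads through an inverse sequence of finite sets *)

Lemma koenig (U : Type) (A : nat -> set U) (f : nat -> U -> U) :
  (forall n, finite_set (A n)) -> (forall n, A n !=set0) ->
  (forall n u, A n.+1 u -> A n (f n u)) ->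
  exists l : nat -> U, forall n, A n (l n) /\ f n (l n.+1) = l n.
Proof.
move=> finA A0 fA.
(* [deep k n u]: [u] is the image of some element of [A (n + k)]. *)
pose fix deep (k n : nat) (u : U) {struct k} : Prop := if k is k'.+1 then
  exists2 v, deep k' n.+1 v & f n v = u else A n u.
have deepS k : forall n u, deep k.+1 n u -> deep k n u.
  elim: k => [|k IHk] n u [v]; first by move=> /= /fA + <-.
  by move=> /IHk ? <-; exists v.
have deep_le j k n u : (j <= k)%N -> deep k n u -> deep j n u.
  elim: k => [|k IHk]; rewrite leq_eqVlt => /predU1P[->//|//].
  by move=> /IHk jk /deepS.
have deepA k n u : deep k n u -> A n u by exact: (@deep_le 0%N).
have deep_ex k : forall n, exists u, deep k n u.
  elim: k => [|k IHk] n; first exact: A0.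
  by have [v ?] := IHk n.+1; exists (f n v), v.
(* Finiteness of [A n] allows the exchange of quantifiers: if every [v] in [P] failed at some depth
   [g v], none would survive at the maximum [N] of these depths over [A n]. *)
have uniform n (P : set U) : (forall k, exists2 v, deep k n v & P v) ->
    exists2 v, forall k, deep k n v & P v.
  move=> h; apply: contrapT => no.
  have {no} shallow v : exists k, P v -> ~ deep k n v.
    apply: contrapT => nk; apply: no; exists v => [k|].
      by apply: contrapT => nd; apply: nk; exists k.
    by apply: contrapT => nP; apply: nk; exists 0%N.
  have [g gP] := choice shallow.
  have [N gN] : exists N, forall v, A n v -> (g v <= N)%N.
    have /finite_seqP[X AX] := finite_image g (finA n).
    exists (\max_(i <- X) i)%N => v Av.
    have : (g @` A n) (g v) by exists v.
    by rewrite AX /= => gX; rewrite (big_rem (g v))//= leq_maxl.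
  have [v dv Pv] := h N; apply: (gP v) => //; apply: deep_le (dv).
  exact: gN (deepA _ _ _ dv).
have [u0 du0 _] : exists2 v, forall k, deep k 0%N v & setT v.
  by apply: uniform => k; have [u ?] := deep_ex k 0%N; exists u.
(* An element that is deep for all [k] has a preimage that is so too. The premise stands under the
   existential, with default [u0], to let [choice] give a total function. *)
have next (nu : nat * U) : exists v, (forall k, deep k nu.1 nu.2) ->
    (forall k, deep k nu.1.+1 v) /\ f nu.1 v = nu.2.
  case: (pselect (forall k, deep k nu.1 nu.2)) => [h|]; last by exists u0.
  have [k|v dv <-] := @uniform nu.1.+1 [set v | f nu.1 v = nu.2].
    by have [v] := h k.+1; exists v.
  by exists v.
have [g gP] := choice next.
pose fix l n := if n is n'.+1 then g (n', l n') else u0.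
have dl n : forall k, deep k n (l n).
  by elim: n => // n IHn; have [] := gP (n, l n) IHn.
exists l => n; split; first exact: (deepA 0%N).
by have [] := gP (n, l n) (dl n).
Qed.

(** * Fine covers of compact spaces and their threads *)

Lemma compact_finite_nbhs_cover (T : topologicalType) (f : T -> set T) :
  compact [set: T] -> (forall x, nbhs x (f x)) ->
  exists2 D, finite_set D & \bigcup_(x in D) f x = setT.
Proof.
move=> /compact_near_coveringP cT fx.
(* The filter of sufficiently large finite sets of centres: those containing [x] cover the
   neighbourhood [f x] of [x]. *)
pose F := filter_from (@finite_set T) (fun D => [set E | finite_set E /\ D `<=` E]).
have FF : Filter F.
  apply: filter_from_filter; first by exists set0.
  move=> D E fD fE; exists (D `|` E); first by rewrite finite_setU.
  by move=> G /= [fG]; rewrite subUset => -[].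
have [x _|D fD DP] := cT _ F (fun E x => exists2 z, E z & f z x) FF.
  exists (f x, [set E | E x]).
    split=> //=; exists [set x] => //.
    by move=> E [_ xE]; apply: xE.
  by move=> [y E] /= [? ?]; exists x.
exists D => //; apply/seteqP; split=> // x _.
by have [z ? ?] := DP D (conj fD (@subset_refl _ D)) x I; exists z.
Qed.

Lemma finite_set_pos_lb (R : realType) (T : Type) (D : set T) (f : T -> R) :
  finite_set D -> (forall x, 0 < f x) ->
  exists2 d : R, 0 < d & forall x, D x -> d <= f x.
Proof.
move=> fD f0.
suff H (X : seq R) : exists2 d : R, 0 < d &
    forall r, r \in X -> 0 < r -> d <= r.
  have /finite_seqP[X DX] := finite_image f fD; have [d d0 dX] := H X.
  exists d => // x Dx; apply: dX => //.
  have : (f @` D) (f x) by exists x.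
  by rewrite DX.
elim: X => [|a X [d d0 dX]]; first by exists 1.
case: (ltP 0 a) => a0.
  exists (Order.min a d) => [|r]; first by rewrite lt_min a0.
  rewrite inE ge_min => /predU1P[->|/dX rX /rX ->]; first by rewrite lexx.
  exact: orbT.
exists d => // r; rewrite inE => /predU1P[->|/dX//].
by rewrite ltNge a0.
Qed.

Lemma fine_refinement (R : realType) (M : metricType R) (s : nat)
    (A : set (set M)) (r : R) :
  compact [set: M] -> covering_dim_le M s -> finite_open_cover A -> 0 < r ->
  exists (B : set (set M)) (d : R),
    [/\ finite_open_cover B, family_order_le B s,
        forall W x y, B W -> W x -> W y -> ball x r y, 0 < d &
        forall W, B W -> exists2 V, A V & forall w, W w -> ball w d `<=` V].
Proof.
move=> cM dM [finA openA coverA] r0.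
(* A member of the refinement will lie within [Ve.2] of a centre. Twice this radius is at most [r],
   which bounds the mesh, and the second [Ve.2] leaves room for the uniform neighbourhood. *)
have pick x : exists Ve : set M * R, [/\ A Ve.1, 0 < Ve.2, Ve.2 <= r / 2 &
    ball x (Ve.2 + Ve.2) `<=` Ve.1].
  have [V AV Vx] : (\bigcup_(U in A) U) x by rewrite coverA.
  have /nbhs_ballP[e /= e0 eV] : nbhs x V by apply: open_nbhs_nbhs; split=> //; exact: openA.
  exists (V, Order.min (e / 2) (r / 2)); split=> //=.
  - by rewrite lt_min !divr_gt0.
  - by rewrite ge_min lexx orbT.
  - apply: subset_trans eV; apply: le_ball.
    by rewrite [leRHS]splitr lerD// ge_min lexx.
have [g gP] := choice pick.
have [D fD DT] : exists2 D, finite_set D & \bigcup_(x in D) (ball x (g x).2)° = setT.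
  apply: compact_finite_nbhs_cover => // x.
  by apply/nbhs_interior/nbhsx_ballx; case: (gP x).
have [|B [coverB BD ordB]] := dM [set (ball x (g x).2)° | x in D].
  split; first exact: finite_image.
    by move=> _ [x _ <-]; exact: open_interior.
  by rewrite bigcup_image.
have [d d0 dD] : exists2 d : R, 0 < d & forall x, D x -> d <= (g x).2.
  by apply: finite_set_pos_lb => // x; case: (gP x).
exists B, d; split=> //.
  move=> W x y /BD[_ [z Dz <-] Wz] /Wz/interior_subset zx /Wz/interior_subset zy.
  have [_ _ zr _] := gP z.
  apply: (@le_ball _ _ _ ((g z).2 + (g z).2)); first by rewrite [leRHS]splitr lerD.
  exact: ball_triangle (ball_sym zx) zy.
move=> W /BD[_ [z Dz <-] Wz]; have [AV _ _ zV] := gP z; exists (g z).1 => //.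
move=> w /Wz/interior_subset zw y wy; apply: zV.
by apply: ball_triangle zw _; apply: le_ball wy; exact: dD.
Qed.

(** The parent depends on the level and the set only, not on the point; hence threads that meet at
    one level agree at all earlier ones. *)
Lemma nested_threads (R : realType) (M : metricType R) (s : nat) :
  compact [set: M] -> covering_dim_le M s ->
  exists (V : nat -> set (set M)) (l : M -> nat -> set M),
    [/\ forall n, finite_set (V n) /\ family_order_le (V n) s,
        forall n W x y, V n W -> W x -> W y -> ball x n.+1%:R^-1 y,
        forall x n, V n (l x n),
        forall x y n, l x n.+1 = l y n.+1 -> l x n = l y n &
        forall n, exists2 d : R, 0 < d & forall x, ball x d `<=` l x n].
Proof.
move=> cM dM.
have refine (An : set (set M) * nat) : exists Bd : set (set M) * R,
    finite_open_cover An.1 ->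
    [/\ finite_open_cover Bd.1, family_order_le Bd.1 s,
      forall W x y, Bd.1 W -> W x -> W y -> ball x An.2.+1%:R^-1 y,
      0 < Bd.2 & forall W, Bd.1 W ->
        exists2 V, An.1 V & forall w, W w -> ball w Bd.2 `<=` V].
  case: (pselect (finite_open_cover An.1)) => [cA|]; last by exists (set0, 0).
  have r0 : 0 < An.2.+1%:R^-1 :> R by rewrite invr_gt0.
  by have [B [d]] := fine_refinement cM dM cA r0; exists (B, d).
have [F FP] := choice refine.
pose fix V n := if n is n'.+1 then (F (V n', n')).1 else [set [set: M]].
have coverV n : finite_open_cover (V n).
  elim: n => [|n IHn]; last by have [] := FP (V n, n) IHn.
  split; first exact: finite_set1.
    by move=> _ ->; exact: openT.
  by rewrite bigcup_set1.
have VP n := FP (V n, n) (coverV n).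
have parent (nW : nat * set M) : exists U, V nW.1.+1 nW.2 ->
    V nW.1 U /\ forall w, nW.2 w -> ball w (F (V nW.1, nW.1)).2 `<=` U.
  case: nW => n W /=.
  case: (pselect ((F (V n, n)).1 W)) => [VW|]; last by exists set0.
  by have [_ _ _ _ /(_ W VW)[U]] := VP n; exists U.
have [p pP] := choice parent.
have thread x : exists l : nat -> set M, forall n,
    (V n (l n) /\ l n x) /\ p (n, l n.+1) = l n.
  apply: (@koenig _ (fun n => [set W | V n W /\ W x]) (fun n W => p (n, W))).
  - move=> n; apply: (@sub_finite_set _ _ (V n)); first by move=> W [].
    by case: (coverV n).
  - move=> n; case: (coverV n) => _ _ cV.
    have [W VW Wx] : (\bigcup_(U in V n) U) x by rewrite cV.
    by exists W.
  - move=> n W [VW Wx]; have [Vp pW] := pP (n, W) VW; split=> //.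
    by apply: (pW x) => //; apply: ballxx; case: (VP n).
have [l lP] := choice thread.
(* Level [0], the whole space, only starts the recursion and has no mesh bound, so the levels are
   shifted by one. *)
exists (fun n => V n.+1), (fun x n => l x n.+1); split.
- by move=> n; case: (VP n) => -[].
- by move=> n W x y; case: (VP n) => _ _ + _ _; exact.
- by move=> x n; case: (lP x n.+1) => -[].
- by move=> x y n e; rewrite -(lP x _).2 -(lP y n.+1).2 e.
- move=> n; exists (F (V n.+1, n.+1)).2; first by case: (VP n.+1).
  move=> x; rewrite -(lP x n.+1).2.
  have [[Vl lx] _] := lP x n.+2.
  by have [_] := pP (n.+1, l x n.+2) Vl; exact.
Qed.

(** * The order by threads and the length of its snakes *)

Theorem theorem1p3 (R : realType) (M : metricType R) (s : nat)
    (compactM : compact [set: M]) (dimM : covering_dim_le M s) :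
  exists lt : M -> M -> Prop,
    strict_total_order lt /\ (snake_number lt <= (2 * s + 1)%:R%:E)%E.
Proof.
have [V [l [VP meshV Vl l_coh lball]]] := nested_threads compactM dimM.
have l_coh_le x y m n : (m <= n)%N -> l x n = l y n -> l x m = l y m.
  by elim: n => [|n IHn]; rewrite leq_eqVlt => /predU1P[->//|//] /IHn + /l_coh.
have l_self x n : l x n x.
  by have [d d0 /(_ x)] := lball n; apply; exact: ballxx.
have l_sep (x y : M) : x <> y -> exists n, forall W, V n W -> W x -> ~ W y.
  move=> /eqP; rewrite -mdist_gt0 => xy0.
  have [n nxy] : exists n, n.+1%:R^-1 < mdist x y.
    exists (Num.trunc (mdist x y)^-1).
    by rewrite invf_plt ?posrE// truncnS_gt.
  exists n => W VW Wx Wy; have := meshV _ _ _ _ VW Wx Wy.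
  by rewrite ballEmdist /= => /(lt_trans nxy); rewrite ltxx.
(* Any numbering of the members of each level will do. *)
have code n : exists f : set M -> nat, {in V n &, injective f}.
  by apply/countable_injP/finite_set_countable; case: (VP n).
have [e e_inj] := choice code.
pose c x n := e n (l x n).
have cE x y n : c x n = c y n -> l x n = l y n by apply: e_inj; rewrite inE.
exists (lexlt c); split.
  apply: lexlt_total_order => x y cxy; apply: contrapT => /l_sep[n].
  by move=> /(_ _ (Vl x n) (l_self x n)); apply; rewrite (cE _ _ _ (cxy n)).
apply: ge_ereal_sup => _ [->|[[x y] /= xy <-]]; first by rewrite lee_fin.
apply: greatest_or_oo_le.
  by move=> e' e'0; exists (fun=> x); split=> // -[|//] _; exact: ballxx.
move=> k snake; rewrite leqNgt; apply/negP => sk.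
have [n nsep] := l_sep x y xy; have [d d0 dl] := lball n.
have [a [a_lt a_in]] := snake d d0.
have a_mono i j : (i < j <= k)%N -> lexlt c (a i) (a j).
  move=> /andP[]; elim: j => // j IHj; rewrite ltnS leq_eqVlt => /predU1P[->|ij jk].
    exact: a_lt.
  by apply: lexlt_trans (a_lt _ jk); apply: IHj => //; exact: ltnW.
have a_l i : (i <= k)%N -> l (a i) n (if odd i then y else x).
  by move=> /a_in; case: odd => /ball_sym; exact: dl.
have l_neq i j : (i < j)%N -> (j.*2 <= k)%N -> l (a i.*2) n <> l (a j.*2) n.
  move=> ij jk eqij.
  have i1j : (i.*2.+1 < j.*2)%N by move: (ij); rewrite -leq_double doubleS.
  have cij m : (m <= n)%N -> c (a i.*2) m = c (a j.*2) m.
    by move=> mn; rewrite /c (l_coh_le _ _ _ _ mn eqij).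
  have ik : (i.*2.+1 <= k)%N by apply: leq_trans jk; exact: ltnW.
  have := lexlt_convex (a_mono i.*2 i.*2.+1 _) (a_mono i.*2.+1 j.*2 _) cij.
  rewrite ltnSn ik i1j jk => /(_ isT isT)/cE eqi.
  apply: (nsep _ (Vl (a i.*2) n)).
    by have := a_l i.*2 (ltnW ik); rewrite odd_double.
  by have := a_l i.*2.+1 ik; rewrite /= odd_double /= eqi.
(* Since [k] is at least [2 * s + 2], the snake has at least [s + 2] points of even index. *)
have s2k i : (i <= s.+1)%N -> (i.*2 <= k)%N.
  by rewrite -leq_double => /leq_trans; apply; rewrite doubleS -mul2n -addn1.
(* These give [s + 2] distinct members of [V n] with the common point [x], against the order bound
   [s]. *)
have [_ /(_ s.+1 [set l (a i.*2) n | i in `I_s.+2])] := VP n.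
rewrite ltnn => H; suff: false by []; apply: H.
- by move=> _ [i _ <-].
- apply: inj_card_eq => i j; rewrite !inE /= !ltnS => /s2k ik /s2k jk eqij.
  by case: (ltngtP i j) => // [/l_neq|/l_neq]; [move/(_ jk)|move/(_ ik)]; rewrite eqij.
- exists x => _ [i /= /s2k ik <-].
  by have := a_l _ ik; rewrite odd_double.
Qed.
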